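(* Let $L_x,L_y>0$, $L_{xy}\geq 0$, and let $F\in\mathcal{F}(L_x, L_y, L_{xy}, 0, 0)$ (i.e. $F$ is smooth convex-concave, see context) with nonempty saddle point set $S^\star$. Let $L=\max\{L_x, L_y\}$. Assume $F$ has a quadratic gradient growth with constant $\mu_F>0$. If $t\in\left(0, \tfrac{2 \mu_F}{L \mu_F+2L_{xy} \sqrt{\mu_F (L-\mu_F)}+L_{xy}^2}\right)$, then for every $(x^1,y^1)\in\mathbb{R}^n\times\mathbb{R}^m$, the point $x^{2}=x^1-t\nabla_x F(x^1, y^1)$, $y^{2}=y^1+t\nabla_y F(x^1, y^1)$ satisfies $$ d_{S^\star}^2((x^2, y^2))\leq \alpha\, d_{S^\star}^2((x^1, y^1)), $$ where $$ \alpha=t \left(2 tL_{xy} \sqrt{\mu_F (L-\mu_F)}+\mu_F (L t-2)+tL_{xy}^2\right)+1. $$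
   Context: $\mathcal{F}(L_x, L_y, L_{xy}, 0, 0)$ denotes the set of differentiable $F:\mathbb{R}^n\times\mathbb{R}^m\to\mathbb{R}$ with $F(\cdot,y)$ convex for all $y$, $F(x,\cdot)$ concave for all $x$, and for all $x,x_1,x_2,y,y_1,y_2$: $\|\nabla_x F(x_2, y)-\nabla_x F(x_1, y)\|\leq L_x\|x_2-x_1\|$; $\|\nabla_y F(x, y_2)-\nabla_y F(x, y_1)\|\leq L_y\|y_2-y_1\|$; $\|\nabla_x F(x, y_2)-\nabla_x F(x, y_1)\|\leq L_{xy}\|y_2-y_1\|$; $\|\nabla_y F(x_2, y)-\nabla_y F(x_1, y)\|\leq L_{xy}\|x_2-x_1\|$. $S^\star$ is the set of saddle points $(x^\star,y^\star)$, i.e. $F(x^\star, y)\leq F(x^\star, y^\star)\leq F(x, y^\star)$ for all $x,y$; it is closed and convex. $d_{S^\star}(z)=\inf_{w\in S^\star}\|z-w\|$. $F$ has quadratic gradient growth with $\mu_F>0$ if for all $(x,y)$: $\langle \nabla_x F(x,y), x-x^\star\rangle-\langle \nabla_y F(x,y), y-y^\star\rangle \geq \mu_F\, d_{S^\star}^2((x,y))$, where $(x^\star,y^\star)$ is the Euclidean projection of $(x,y)$ onto $S^\star$. *)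

(* Defs.v *)
From HB Require Import structures.
From mathcomp Require Import all_boot all_order all_algebra.
From mathcomp Require Import all_classical all_reals all_analysis.
Set Implicit Arguments. Unset Strict Implicit. Unset Printing Implicit Defensive.
Import Order.TTheory GRing.Theory Num.Theory.
Import numFieldNormedType.Exports.
Local Open Scope classical_set_scope.
Local Open Scope ring_scope.

Definition dotv {R : realType} {n : nat} (u v : 'rV[R]_n) : R :=
  \sum_(i < n) u 0 i * v 0 i.
Definition enorm {R : realType} {n : nat} (u : 'rV[R]_n) : R :=
  Num.sqrt (dotv u u).

Definition edist {R : realType} {n m : nat}
  (z w : 'rV[R]_n * 'rV[R]_m) : R :=
  Num.sqrt (dotv (z.1 - w.1) (z.1 - w.1) + dotv (z.2 - w.2) (z.2 - w.2)).

Definition saddle_set {R : realType} {n m : nat}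
  (F : 'rV[R]_n * 'rV[R]_m -> R) : set ('rV[R]_n * 'rV[R]_m) :=
  [set s | forall (x : 'rV[R]_n) (y : 'rV[R]_m),
     F (s.1, y) <= F s /\ F s <= F (x, s.2)].

Definition dist_set {R : realType} {n m : nat}
  (S : set ('rV[R]_n * 'rV[R]_m)) (z : 'rV[R]_n * 'rV[R]_m) : R :=
  inf [set edist z w | w in S].

Definition has_partial_grads {R : realType} {n m : nat}
  (F : 'rV[R]_n * 'rV[R]_m -> R)
  (gx : 'rV[R]_n -> 'rV[R]_m -> 'rV[R]_n)
  (gy : 'rV[R]_n -> 'rV[R]_m -> 'rV[R]_m) : Prop :=
  forall (x : 'rV[R]_n) (y : 'rV[R]_m),
    differentiable F (x, y) /\
    forall (h : 'rV[R]_n) (k : 'rV[R]_m),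
      'd F (x, y) (h, k) = dotv (gx x y) h + dotv (gy x y) k.

Definition convex_concave_smooth {R : realType} {n m : nat}
  (Lx Ly Lxy : R) (F : 'rV[R]_n * 'rV[R]_m -> R)
  (gx : 'rV[R]_n -> 'rV[R]_m -> 'rV[R]_n)
  (gy : 'rV[R]_n -> 'rV[R]_m -> 'rV[R]_m) : Prop :=
  [/\ has_partial_grads F gx gy,
      (forall (y : 'rV[R]_m) (x1 x2 : 'rV[R]_n) (l : R), 0 <= l <= 1 ->
         F (l *: x1 + (1 - l) *: x2, y) <= l * F (x1, y) + (1 - l) * F (x2, y)),
      (forall (x : 'rV[R]_n) (y1 y2 : 'rV[R]_m) (l : R), 0 <= l <= 1 ->
         l * F (x, y1) + (1 - l) * F (x, y2) <= F (x, l *: y1 + (1 - l) *: y2)),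
      (forall x1 x2 y, enorm (gx x2 y - gx x1 y) <= Lx * enorm (x2 - x1)) &
   [/\ (forall x y1 y2, enorm (gy x y2 - gy x y1) <= Ly * enorm (y2 - y1)),
       (forall x y1 y2, enorm (gx x y2 - gx x y1) <= Lxy * enorm (y2 - y1)) &
       (forall x1 x2 y, enorm (gy x2 y - gy x1 y) <= Lxy * enorm (x2 - x1))]].

(* Quadratic gradient growth with constant mu; the point s = (xs,ys) is the Euclidean
   projection of (x,y) onto the saddle set, i.e. a saddle point at distance d_S(x,y)
   (unique since the saddle set is closed convex). *)
Definition quad_grad_growth {R : realType} {n m : nat}
  (mu : R) (F : 'rV[R]_n * 'rV[R]_m -> R)
  (gx : 'rV[R]_n -> 'rV[R]_m -> 'rV[R]_n)
  (gy : 'rV[R]_n -> 'rV[R]_m -> 'rV[R]_m) : Prop :=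
  forall (x : 'rV[R]_n) (y : 'rV[R]_m) (s : 'rV[R]_n * 'rV[R]_m),
    saddle_set F s ->
    edist (x, y) s = dist_set (saddle_set F) (x, y) ->
    dotv (gx x y) (x - s.1) - dotv (gy x y) (y - s.2)
      >= mu * (dist_set (saddle_set F) (x, y)) ^+ 2.

(* Main.v *)
(**
Let [s] be the projection of [z1 = (x1, y1)] on the saddle set, [z = z1 - s],
[G = (gx z1, - gy z1)], and [nu = <G, z> / |z|^2], so that [nu >= mu] by
quadratic growth. Since [d(z2)^2 <= |z - t G|^2], everything reduces to
[|G|^2 <= K(nu) |z|^2] with
[K(nu) = L nu + 2 Lxy sqrt (nu (L - nu)) + Lxy^2], that is, to
[|G - nu z| <= (sqrt (nu (L - nu)) + Lxy) |z|].

Write [V] for the change of [G] when, in each block, the block's own variable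
moves from [s] to [z1] and the other one stays at its [z1] value, and [W] for
the same change with the other variable at its [s] value. Both [G - V] and
[G - W] have norm at most [Lxy |z|]. Summing the interpolation inequalities of
smooth convex functions around the rectangle with corners [s] and [z1], in the
two possible orientations, the function values cancel and
[|V|^2 + |W|^2 <= 2 L <G, z>],
[|V|^2 + |W|^2 <= 2 L (<V, z> + <W, z> - <G, z>)].
Weighting these by [1 - nu / L] and [nu / L] shows that [V] or [W] lies within
[sqrt (nu (L - nu)) |z|] of [nu z].
*)
Require Import Defs.
From HB Require Import structures.
From mathcomp Require Import all_boot all_order all_algebra.
From mathcomp Require Import all_classical all_reals all_analysis.
From mathcomp Require Import ring lra.
Import Order.TTheory GRing.Theory Num.Theory.
Import numFieldNormedType.Exports.
Local Open Scope classical_set_scope.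
Local Open Scope ring_scope.

(** * Euclidean inner product *)

Section Dot.
Context {R : realType} {n : nat}.
Implicit Types (u v w : 'rV[R]_n) (a : R).

Lemma dotvC u v : dotv u v = dotv v u.
Proof. by apply: eq_bigr => i _; rewrite mulrC. Qed.

Lemma dotvDl u v w : dotv (u + v) w = dotv u w + dotv v w.
Proof. by rewrite /dotv -big_split; apply: eq_bigr => i _; rewrite mxE mulrDl. Qed.

Lemma dotvZl a u w : dotv (a *: u) w = a * dotv u w.
Proof. by rewrite /dotv mulr_sumr; apply: eq_bigr => i _; rewrite mxE mulrA. Qed.

Lemma dotvNl u w : dotv (- u) w = - dotv u w.
Proof. by rewrite -scaleN1r dotvZl mulN1r. Qed.

Lemma dotvDr u v w : dotv w (u + v) = dotv w u + dotv w v.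
Proof. by rewrite dotvC dotvDl !(dotvC w). Qed.

Lemma dotvZr a u w : dotv w (a *: u) = a * dotv w u.
Proof. by rewrite dotvC dotvZl dotvC. Qed.

Lemma dotvNr u w : dotv w (- u) = - dotv w u.
Proof. by rewrite dotvC dotvNl dotvC. Qed.

Lemma dotv0l u : dotv 0 u = 0.
Proof. by rewrite -(scale0r u) dotvZl mul0r. Qed.

Lemma dotv0r u : dotv u 0 = 0.
Proof. by rewrite dotvC dotv0l. Qed.

Lemma dotv_ge0 u : 0 <= dotv u u.
Proof. by apply: sumr_ge0 => i _; rewrite -expr2 sqr_ge0. Qed.

Lemma dotv_eq0 u : dotv u u = 0 -> u = 0.
Proof.
move=> /psumr_eq0P u0; apply/rowP => i; apply/eqP.
rewrite mxE -sqrf_eq0 expr2; apply/eqP/u0 => // j _.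
by rewrite -expr2 sqr_ge0.
Qed.

Lemma enorm_ge0 u : 0 <= enorm u.
Proof. exact: sqrtr_ge0. Qed.

Lemma sqr_enorm u : enorm u ^+ 2 = dotv u u.
Proof. by rewrite sqr_sqrtr ?dotv_ge0. Qed.

(** Cauchy-Schwarz, by expanding the square of [enorm v *: u - enorm u *: v]. Zero vectors come
    first because the factor [enorm u * enorm v] is cancelled. *)
Lemma dotv_le_enorm u v : dotv u v <= enorm u * enorm v.
Proof.
have [v0|v0] := eqVneq (enorm v) 0.
  have := sqr_enorm v; rewrite v0 expr0n /= => /esym/dotv_eq0 ->.
  by rewrite dotv0r mulr0.
have vgt0 : 0 < enorm v by rewrite lt_def v0 enorm_ge0.
have [u0|u0] := eqVneq (enorm u) 0.
  have := sqr_enorm u; rewrite u0 expr0n /= => /esym/dotv_eq0 ->.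
  by rewrite dotv0l mul0r.
have ugt0 : 0 < enorm u by rewrite lt_def u0 enorm_ge0.
have := dotv_ge0 (enorm v *: u - enorm u *: v).
rewrite !(dotvDl, dotvDr, dotvNl, dotvNr, dotvZl, dotvZr) -!sqr_enorm (dotvC v u).
move: (enorm u) (enorm v) ugt0 vgt0 (dotv u v) => p q p0 q0 c H.
have pq : 0 < p * q by rewrite mulr_gt0.
by rewrite -(ler_pM2l pq); lra.
Qed.

Lemma enormN u : enorm (- u) = enorm u.
Proof. by rewrite /enorm dotvNl dotvNr opprK. Qed.

Lemma enormD u v : enorm (u + v) <= enorm u + enorm v.
Proof.
rewrite -ler_sqr ?nnegrE ?addr_ge0 ?enorm_ge0// sqr_enorm.
rewrite !(dotvDl, dotvDr) (dotvC v u) sqrrD -!sqr_enorm.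
by have := dotv_le_enorm u v; lra.
Qed.

End Dot.

(** * Smooth convex functions *)

(** A gradient in the directional (Gateaux) sense, suited to one-variable arguments along lines. *)
Definition is_gradient {R : realType} {n : nat} (f : 'rV[R]_n -> R)
    (g : 'rV[R]_n -> 'rV[R]_n) :=
  forall x v, is_derive x v f (dotv (g x) v).

Section Smooth.
Context {R : realType} {n : nat} {L : R}.
Implicit Types (f : 'rV[R]_n -> R) (g : 'rV[R]_n -> 'rV[R]_n).

Lemma is_gradientN f g :
  is_gradient f g -> is_gradient (fun x => - f x) (fun x => - g x).
Proof. by move=> fg x v; rewrite dotvNl; apply: is_deriveN; apply: fg. Qed.

Lemma is_gradient_line f g x v (s : R) : is_gradient f g ->
  is_derive s (1 : R) (fun r : R => f (x + r *: v)) (dotv (g (x + s *: v)) v).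
Proof.
move=> fg; have [dv <-] := fg (x + s *: v) v.
have E : (fun h : R => h^-1 *: (((fun r : R => f (x + r *: v)) \o shift s) (h *: 1%R)
           - f (x + s *: v))) =
         (fun h : R => h^-1 *: ((f \o shift (x + s *: v)) (h *: v) - f (x + s *: v))).
  apply/funext => h /=; congr (_ *: (f _ - _)).
  by rewrite [h *: 1%R]mulr1 scalerDl addrCA.
by split; rewrite /derivable /derive E.
Qed.

Lemma descent f g x v : 0 < L -> is_gradient f g ->
  (forall x1 x2, enorm (g x2 - g x1) <= L * enorm (x2 - x1)) ->
  f (x + v) <= f x + dotv (g x) v + L / 2 * dotv v v.
Proof.
move=> L0 fg Lip.
(* Up to a constant, [psi] is [f] on the segment minus its quadratic upper model. The claim is
   [psi 1 <= psi 0], so a nonpositive derivative at the mean value point suffices. *)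
pose psi (r : R) := f (x + r *: v) - r * dotv (g x) v - r ^+ 2 * (L / 2 * dotv v v).
pose dpsi (r : R) := dotv (g (x + r *: v)) v - dotv (g x) v - r * L * dotv v v.
have dps (r : R) : is_derive r (1 : R) psi (dpsi r).
  have := is_gradient_line _ _ x v r fg => D.
  rewrite /psi; apply: is_derive_eq.
  rewrite /dpsi /GRing.scale /=.
  by field.
have [|c c01] := @MVT R psi dpsi 0 1 ltr01 (fun r _ => dps r).
  apply: continuous_subspaceT => r.
  by apply: differentiable_continuous; apply/derivable1_diffP; have [] := dps r.
rewrite /psi subr0 mulr1 scale0r addr0 scale1r => E.
suff : dpsi c <= 0 by move: E; rewrite expr0n /= expr1n; lra.
move: c01; rewrite in_itv /= => /andP[c0 c1].
rewrite /dpsi -dotvNl -dotvDl.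
have H1 := dotv_le_enorm (g (x + c *: v) - g x) v.
have := Lip x (x + c *: v).
have -> : x + c *: v - x = c *: v by rewrite addrAC subrr add0r.
have -> : enorm (c *: v) = c * enorm v.
  by rewrite /enorm dotvZl dotvZr mulrA -expr2 sqrtrM ?sqr_ge0// sqrtr_sqr gtr0_norm.
move=> H2; have := ler_wpM2r (enorm_ge0 v) H2.
by rewrite -sqr_enorm; lra.
Qed.
(** Instead of letting the step tend to 0 in the convexity inequality, [descent] for [- f] bounds
    the linearization error, and one explicit step gives the contradiction. *)
Lemma convex_gradient_le f g x y : 0 < L -> is_gradient f g ->
  (forall x1 x2, enorm (g x2 - g x1) <= L * enorm (x2 - x1)) ->
  (forall (x1 x2 : 'rV[R]_n) (l : R), 0 <= l <= 1 ->
     f (l *: x1 + (1 - l) *: x2) <= l * f x1 + (1 - l) * f x2) ->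
  f x + dotv (g x) (y - x) <= f y.
Proof.
move=> L0 fg Lip cvx; rewrite leNgt; apply/negP => lt_fy.
pose v := y - x; pose D := f x + dotv (g x) v - f y; pose C := L / 2 * dotv v v.
have D0 : 0 < D by rewrite /D subr_gt0.
have C0 : 0 <= C by rewrite mulr_ge0 ?dotv_ge0// divr_ge0// ltW.
have NLip x1 x2 : enorm (- g x2 - - g x1) <= L * enorm (x2 - x1).
  by rewrite -opprD enormN; apply: Lip.
have CD : 0 < C + D by lra.
(* The bounds [lower] and [upper] give [D <= s * C], whereas this choice makes
   [s * C = D - s * D < D]; it lies in (0, 1] even if [C = 0]. *)
pose s := D / (C + D).
have s0 : 0 < s by rewrite divr_gt0.
have s1 : s <= 1 by rewrite ler_pdivrMr// mul1r; lra.
have lower := descent _ _ x (s *: v) L0 (is_gradientN _ _ fg) NLip.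
have upper : f (x + s *: v) <= s * f y + (1 - s) * f x.
  have -> : x + s *: v = s *: y + (1 - s) *: x.
    by rewrite /v scalerBr scalerBl scale1r addrCA addrA.
  by apply: cvx; rewrite ltW.
rewrite dotvNl !(dotvZl, dotvZr) in lower.
have key : s * D <= s * (s * C) by rewrite /D /C; lra.
rewrite ler_pM2l// in key.
have : s * (C + D) = D by rewrite /s divfK// gt_eqF.
by nra.
Qed.

(* Cocoercivity: compare the convex lower bound at [x] with the descent upper
   bound at [y], both evaluated at [y - (g y - g x) / L]. *)
Lemma convex_interpolation f g x y : 0 < L -> is_gradient f g ->
  (forall x1 x2, enorm (g x2 - g x1) <= L * enorm (x2 - x1)) ->
  (forall (x1 x2 : 'rV[R]_n) (l : R), 0 <= l <= 1 ->
     f (l *: x1 + (1 - l) *: x2) <= l * f x1 + (1 - l) * f x2) ->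
  f x + dotv (g x) (y - x) + dotv (g y - g x) (g y - g x) / (2 * L) <= f y.
Proof.
move=> L0 fg Lip cvx.
pose w := g y - g x.
have up := descent _ _ y (- (L^-1 *: w)) L0 fg Lip.
have lo := convex_gradient_le _ _ x (y - L^-1 *: w) L0 fg Lip cvx.
have E : dotv w w = dotv (g y) w - dotv (g x) w by rewrite {1}/w dotvDl dotvNl.
rewrite -/w.
rewrite !(dotvNl, dotvNr, dotvZl, dotvZr) in up.
rewrite (addrAC y) dotvDr dotvNr dotvZr in lo.
have -> : dotv w w / (2 * L) =
    L^-1 * (dotv (g y) w - dotv (g x) w) - L / 2 * - - (L^-1 * (L^-1 * dotv w w)).
  by rewrite -E; field; rewrite gt_eqF.
by lra.
Qed.

(** By [descent], a gradient step of length [1 / L] would lower [f] by at least [|g x|^2 / (2 L)],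
    which a minimizer forbids. *)
Lemma gradient_eq0_of_min f g x : 0 < L -> is_gradient f g ->
  (forall x1 x2, enorm (g x2 - g x1) <= L * enorm (x2 - x1)) ->
  (forall y, f x <= f y) -> g x = 0.
Proof.
move=> L0 fg Lip fmin; apply: dotv_eq0; apply/eqP.
rewrite eq_le dotv_ge0 andbT.
have := le_trans (fmin _) (descent _ _ x (- (L^-1 *: g x)) L0 fg Lip).
rewrite !(dotvNl, dotvNr, dotvZl, dotvZr).
have -> : L / 2 * - - (L^-1 * (L^-1 * dotv (g x) (g x))) = L^-1 * dotv (g x) (g x) / 2.
  by field; rewrite gt_eqF.
move=> H; have : L^-1 * dotv (g x) (g x) <= 0 by lra.
by rewrite pmulr_rle0// invr_gt0.
Qed.
End Smooth.

(** Concatenated rows make the product space a single Euclidean space, where the estimates on [G],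
    [V], [W] and [z] take place. *)
Lemma dotv_row_mx {R : realType} {n m : nat} (a c : 'rV[R]_n) (b d : 'rV[R]_m) :
  dotv (row_mx a b) (row_mx c d) = dotv a c + dotv b d.
Proof.
rewrite /dotv big_split_ord /=; congr (_ + _); apply: eq_bigr => i _.
  by rewrite !row_mxEl.
by rewrite !row_mxEr.
Qed.

Lemma is_gradient_fst {R : realType} {n m : nat} (F : 'rV[R]_n * 'rV[R]_m -> R) gx gy y :
  has_partial_grads F gx gy -> is_gradient (fun x => F (x, y)) (gx ^~ y).
Proof.
move=> FG x v; have [dF dE] := FG x y.
have := deriveE (v, 0) dF; rewrite dE dotv0r addr0 => <-.
have E : (fun h : R => h^-1 *: ((F \o shift (x, y)) (h *: (v, 0)) - F (x, y))) =
         (fun h : R => h^-1 *: (((fun x => F (x, y)) \o shift x) (h *: v) - F (x, y))).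
  apply/funext => h /=; congr (_ *: (F _ - _)).
  by apply: injective_projections => /=; rewrite ?scaler0 ?add0r.
have dv : derivable F (x, y) (v, 0) by exact: diff_derivable.
split; last by rewrite /derive E.
by move: dv; rewrite /derivable E.
Qed.

Lemma is_gradient_snd {R : realType} {n m : nat} (F : 'rV[R]_n * 'rV[R]_m -> R) gx gy x :
  has_partial_grads F gx gy -> is_gradient (fun y => F (x, y)) (gy x).
Proof.
move=> FG y v; have [dF dE] := FG x y.
have := deriveE (0, v) dF; rewrite dE dotv0r add0r => <-.
have E : (fun h : R => h^-1 *: ((F \o shift (x, y)) (h *: (0, v)) - F (x, y))) =
         (fun h : R => h^-1 *: (((fun y => F (x, y)) \o shift y) (h *: v) - F (x, y))).
  apply/funext => h /=; congr (_ *: (F _ - _)).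
  by apply: injective_projections => /=; rewrite ?scaler0 ?add0r.
have dv : derivable F (x, y) (0, v) by exact: diff_derivable.
split; last by rewrite /derive E.
by move: dv; rewrite /derivable E.
Qed.

(** * Gradient norm bound *)

(** The function [K] of the overview, with [M] for [Lxy]. At [nu = mu] it is the denominator of the
    step bound, and [alpha = 1 - 2 t mu + t^2 K(mu)]. *)
Definition growth_rate {R : realType} (L M nu : R) : R :=
  L * nu + 2 * M * Num.sqrt (nu * (L - nu)) + M ^+ 2.

(** The quotient [K(nu) / nu = L + 2 M sqrt (L / nu - 1) + M^2 / nu] is nonincreasing term by term
    on (0, L]. *)
Lemma growth_rate_ratio_le {R : realType} (L M mu nu : R) :
  0 < mu -> 0 <= M -> mu <= nu -> nu <= L ->
  mu * growth_rate L M nu <= nu * growth_rate L M mu.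
Proof.
move=> mu0 M0 munu nuL.
have nu0 : 0 < nu by apply: lt_le_trans munu.
have key : mu * Num.sqrt (nu * (L - nu)) <= nu * Num.sqrt (mu * (L - mu)).
  rewrite -(@ler_sqr R) ?nnegrE ?mulr_ge0 ?sqrtr_ge0 ?(ltW mu0) ?(ltW nu0)//.
  have rmu0 : 0 <= mu * (L - mu) by apply: mulr_ge0; lra.
  have rnu0 : 0 <= nu * (L - nu) by apply: mulr_ge0; lra.
  rewrite !exprMn !sqr_sqrtr//.
  have H : 0 <= mu * nu * L * (nu - mu) by rewrite !mulr_ge0 ?subr_ge0//; lra.
  by lra.
have := ler_wpM2l M0 key.
have : 0 <= M ^+ 2 * (nu - mu) by rewrite mulr_ge0 ?sqr_ge0// subr_ge0.
by rewrite /growth_rate; lra.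
Qed.

(** By [backward], [2 L <G, z>] is at most [2 L <V + W, z> - |V|^2 - |W|^2], which is at most
    [2 L^2 |z|^2] after completing squares. This keeps the radicand [nu (L - nu)] nonnegative;
    [Num.sqrt] would be 0 on a negative one. *)
Lemma slope_le_lipschitz {R : realType} {N : nat} (L nu : R) (G V W z : 'rV[R]_N) :
  0 < L -> 0 < dotv z z -> dotv G z = nu * dotv z z ->
  dotv V V + dotv W W <= 2 * L * dotv G z ->
  dotv V V + dotv W W <= 2 * L * (dotv V z + dotv W z - dotv G z) ->
  nu <= L.
Proof.
move=> L0 z0 nuE forward backward.
have := dotv_ge0 (V - L *: z); have := dotv_ge0 (W - L *: z).
rewrite !(dotvDl, dotvDr, dotvNl, dotvNr, dotvZl, dotvZr) (dotvC z V) (dotvC z W).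
move=> H1 H2; have : 2 * L * (dotv G z) <= 2 * L * (L * dotv z z) by lra.
by rewrite ler_pM2l ?mulr_gt0// nuE ler_pM2r.
Qed.

(** The triangle inequality through [U] gives [|G - nu z| <= (r + M) |z|] with
    [r = sqrt (nu (L - nu))]. As [G - nu z] is orthogonal to [z], Pythagoras adds [nu^2 |z|^2], and
    [(r + M)^2 + nu^2 = K(nu)]. *)
Lemma norm_le_of_near {R : realType} {N : nat} (L M nu : R) (G U z : 'rV[R]_N) :
  0 <= M -> 0 <= nu -> nu <= L -> dotv G z = nu * dotv z z ->
  dotv (U - nu *: z) (U - nu *: z) <= nu * (L - nu) * dotv z z ->
  dotv (G - U) (G - U) <= M ^+ 2 * dotv z z ->
  dotv G G <= growth_rate L M nu * dotv z z.
Proof.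
move=> M0 nu0 nuL nuE HU HGU.
have rad0 : 0 <= nu * (L - nu) by rewrite mulr_ge0 ?subr_ge0.
pose r := Num.sqrt (nu * (L - nu)).
have r2 : r ^+ 2 = nu * (L - nu) by rewrite sqr_sqrtr.
have r0 : 0 <= r by apply: sqrtr_ge0.
have nU : enorm (U - nu *: z) <= r * enorm z.
  by rewrite -ler_sqr ?nnegrE ?mulr_ge0 ?enorm_ge0// exprMn !sqr_enorm r2.
have nGU : enorm (G - U) <= M * enorm z.
  by rewrite -ler_sqr ?nnegrE ?mulr_ge0 ?enorm_ge0// exprMn !sqr_enorm.
have nG : enorm (G - nu *: z) <= (r + M) * enorm z.
  have -> : G - nu *: z = (U - nu *: z) + (G - U) by rewrite [RHS]addrC subrKA.
  by apply: (le_trans (enormD _ _)); rewrite mulrDl lerD.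
have : enorm (G - nu *: z) ^+ 2 <= ((r + M) * enorm z) ^+ 2.
  by rewrite ler_sqr ?nnegrE ?mulr_ge0 ?addr_ge0 ?enorm_ge0.
rewrite exprMn !sqr_enorm !(dotvDl, dotvDr, dotvNl, dotvNr, dotvZl, dotvZr).
rewrite (dotvC z G) nuE sqrrD r2 /growth_rate -/r.
by lra.
Qed.

Lemma operator_norm_le {R : realType} {N : nat} (L M nu : R) (G V W z : 'rV[R]_N) :
  0 < L -> 0 <= M -> 0 < dotv z z -> dotv G z = nu * dotv z z ->
  dotv V V + dotv W W <= 2 * L * dotv G z ->
  dotv V V + dotv W W <= 2 * L * (dotv V z + dotv W z - dotv G z) ->
  dotv (G - V) (G - V) <= M ^+ 2 * dotv z z ->
  dotv (G - W) (G - W) <= M ^+ 2 * dotv z z ->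
  dotv G G <= growth_rate L M nu * dotv z z.
Proof.
move=> L0 M0 z0 nuE forward backward HV HW.
have nuL := slope_le_lipschitz L nu G V W z L0 z0 nuE forward backward.
have nu0 : 0 <= nu.
  rewrite -(pmulr_lge0 _ z0) -nuE -(@pmulr_rge0 _ (2 * L)) ?mulr_gt0//.
  by apply: le_trans forward; rewrite addr_ge0 ?dotv_ge0.
have [|farV] := leP (dotv (V - nu *: z) (V - nu *: z)) (nu * (L - nu) * dotv z z).
  by move=> nearV; apply: (norm_le_of_near L M nu G V z).
have [|farW] := leP (dotv (W - nu *: z) (W - nu *: z)) (nu * (L - nu) * dotv z z).
  by move=> nearW; apply: (norm_le_of_near L M nu G W z).
exfalso.
have a0 : 0 <= L - nu by rewrite subr_ge0.
(* The weighted sum, divided by [L], reads [|V - nu z|^2 + |W - nu z|^2 <= 2 nu (L - nu) |z|^2], so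
   [V] and [W] cannot both be far. *)
have H1 := ler_wpM2l a0 forward; have H2 := ler_wpM2l nu0 backward.
have := ltrD farV farW.
rewrite !(dotvDl, dotvDr, dotvNl, dotvNr, dotvZl, dotvZr) (dotvC z V) (dotvC z W).
rewrite -(ltr_pM2l L0).
rewrite nuE in H1 H2.
by lra.
Qed.

(* The claim is affine in [t] after division by [t]; at the largest step
   [t = 2 mu / K(mu)] it says [mu K(nu) <= nu K(mu)]. *)
Lemma step_contraction {R : realType} {N : nat} (L M mu t : R) (G V W z : 'rV[R]_N) :
  0 < L -> 0 <= M -> 0 < mu -> 0 < dotv z z ->
  mu * dotv z z <= dotv G z ->
  dotv V V + dotv W W <= 2 * L * dotv G z ->
  dotv V V + dotv W W <= 2 * L * (dotv V z + dotv W z - dotv G z) ->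
  dotv (G - V) (G - V) <= M ^+ 2 * dotv z z ->
  dotv (G - W) (G - W) <= M ^+ 2 * dotv z z ->
  0 < t -> t < 2 * mu / growth_rate L M mu ->
  dotv (z - t *: G) (z - t *: G) <=
    (1 - 2 * t * mu + t ^+ 2 * growth_rate L M mu) * dotv z z.
Proof.
move=> L0 M0 mu0 z0 growth fwd bwd HV HW t0 tK.
pose nu := dotv G z / dotv z z.
have nuE : dotv G z = nu * dotv z z by rewrite divfK// gt_eqF.
have munu : mu <= nu by rewrite ler_pdivlMr.
have nuL := slope_le_lipschitz L nu G V W z L0 z0 nuE fwd bwd.
have normG := operator_norm_le L M nu G V W z L0 M0 z0 nuE fwd bwd HV HW.
have star := growth_rate_ratio_le L M mu nu mu0 M0 munu nuL.
have K0 : 0 < growth_rate L M mu.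
  by rewrite /growth_rate !ltr_wpDr ?mulr_ge0 ?sqrtr_ge0 ?sqr_ge0 ?mulr_gt0.
rewrite ltr_pdivlMr// in tK.
have rate : t * (growth_rate L M nu - growth_rate L M mu) <= 2 * (nu - mu).
  rewrite -(ler_pM2l mu0).
  have H1 : t * (mu * growth_rate L M nu) <= t * (nu * growth_rate L M mu).
    by rewrite ler_pM2l.
  have H2 : (nu - mu) * (t * growth_rate L M mu) <= (nu - mu) * (2 * mu).
    by rewrite ler_wpM2l ?subr_ge0// ltW.
  by lra.
rewrite !(dotvDl, dotvDr, dotvNl, dotvNr, dotvZl, dotvZr) (dotvC z G) nuE.
have H1 := ler_wpM2l (ltW (mulr_gt0 t0 t0)) normG.
have H2 := ler_wpM2l (ltW (mulr_gt0 t0 z0)) rate.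
by lra.
Qed.

(** * Projection on the saddle set *)

Lemma continuous_dotv_sub {R : realType} {k : nat} (a : 'rV[R]_k) :
  continuous (fun u : 'rV[R]_k => dotv (a - u) (a - u)).
Proof.
apply: (@continuous_big R 'I_k +%R 0 xpredT).
  by move=> x; apply: cvgD; [exact: cvg_fst|exact: cvg_snd].
move=> i _ u.
have cu : {for u, continuous (fun w : 'rV[R]_k => (a - w) 0 i)}.
  rewrite (_ : (fun w : 'rV[R]_k => _) = (fun w : 'rV[R]_k => a 0 i - w 0 i)).
    by apply: continuousB; [exact: cst_continuous|exact: coord_continuous].
  by apply/funext => w; rewrite !mxE.
exact: (continuousM cu cu).
Qed.

Lemma continuous_edist {R : realType} {n m : nat} (z : 'rV[R]_n * 'rV[R]_m) :
  continuous (Defs.edist z).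
Proof.
move=> w.
have c1 : {for w, continuous
    (fun v : 'rV[R]_n * 'rV[R]_m => dotv (z.1 - v.1) (z.1 - v.1))}.
  have := @continuous_comp _ _ _ (@fst 'rV[R]_n 'rV[R]_m)
    (fun u => dotv (z.1 - u) (z.1 - u)) w.
  by apply; [exact: cvg_fst|exact: continuous_dotv_sub].
have c2 : {for w, continuous
    (fun v : 'rV[R]_n * 'rV[R]_m => dotv (z.2 - v.2) (z.2 - v.2))}.
  have := @continuous_comp _ _ _ (@snd 'rV[R]_n 'rV[R]_m)
    (fun u => dotv (z.2 - u) (z.2 - u)) w.
  by apply; [exact: cvg_snd|exact: continuous_dotv_sub].
exact: (continuous_comp (continuousD c1 c2) (@sqrt_continuous R _)).
Qed.

(** An intersection, over all [(x, y)], of sets cut out by weak inequalities between continuous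
    functions. *)
Lemma closed_saddle_set {R : realType} {n m : nat} (F : 'rV[R]_n * 'rV[R]_m -> R) :
  continuous F -> closed (saddle_set F).
Proof.
move=> Fc.
have le_closed (G H : 'rV[R]_n * 'rV[R]_m -> R) :
    continuous G -> continuous H -> closed [set s | G s <= H s].
  move=> Gc Hc.
  rewrite (_ : [set s | _] = (fun s => H s - G s) @^-1` [set r | 0 <= r]).
    apply: preimage_closed; last exact: closed_ge.
    by move=> s _; apply: cvgB; [exact: Hc|exact: Gc].
  by apply/seteqP; split=> s /=; rewrite subr_ge0.
have comp_cont (h : 'rV[R]_n * 'rV[R]_m -> 'rV[R]_n * 'rV[R]_m) :
    continuous h -> continuous (F \o h).
  by move=> hc w; apply: continuous_comp; [exact: hc|exact: Fc].
rewrite (_ : saddle_set F =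
    \bigcap_(xy in [set: 'rV[R]_n * 'rV[R]_m])
      ([set s | F (s.1, xy.2) <= F s] `&` [set s | F s <= F (xy.1, s.2)])).
  apply: closed_bigI => -[x y] _; apply: closedI; apply: le_closed => //=.
    apply: (comp_cont (fun s : 'rV[R]_n * 'rV[R]_m => (s.1, y))) => w.
    by apply: (@cvg_pair _ _ _ _ (nbhs w.1) (nbhs y)); [exact: cvg_fst|exact: cvg_cst].
  apply: (comp_cont (fun s : 'rV[R]_n * 'rV[R]_m => (x, s.2))) => w.
  by apply: (@cvg_pair _ _ _ _ (nbhs x) (nbhs w.2)); [exact: cvg_cst|exact: cvg_snd].
apply/seteqP; split=> [s sF [x y] _|s sF x y]; first exact: sF.
exact: (sF (x, y) I).
Qed.

Lemma dist_set_le {R : realType} {n m : nat} (S : set ('rV[R]_n * 'rV[R]_m)) z s :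
  S s -> dist_set S z <= Defs.edist z s.
Proof.
move=> Ss; apply: ge_inf; last by exists s.
by exists 0 => _ [w _ <-]; apply: sqrtr_ge0.
Qed.

Lemma dist_set_ge0 {R : realType} {n m : nat} (S : set ('rV[R]_n * 'rV[R]_m)) z :
  S !=set0 -> 0 <= dist_set S z.
Proof.
move=> [s Ss]; apply: lb_le_inf; first by exists (Defs.edist z s), s.
by move=> _ [w _ <-]; apply: sqrtr_ge0.
Qed.

(** Quadratic growth speaks only of points attaining the distance, so one must exist. The Euclidean
    ball of radius [r] around [z] lies in a product of compact boxes, hence [edist] has a minimum on
    the part of [S] inside it. *)
Lemma exists_projection {R : realType} {n m : nat} (S : set ('rV[R]_n * 'rV[R]_m)) z :
  closed S -> S !=set0 -> exists2 s, S s & Defs.edist z s = dist_set S z.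
Proof.
move=> Scl [s0 Ss0]; pose r := Defs.edist z s0.
pose box k (a : 'rV[R]_k) :=
  [set u : 'rV[R]_k | forall i, `[a 0 i - r, a 0 i + r]%classic (u 0 i)].
have box_compact k (a : 'rV[R]_k) : compact (box k a).
  apply: (@rV_compact R k (fun i => `[a 0 i - r, a 0 i + r]%classic)) => i.
  exact: segment_compact.
have coord_le k (a u : 'rV[R]_k) i : (a 0 i - u 0 i) ^+ 2 <= dotv (a - u) (a - u).
  rewrite /dotv (bigD1 i)//= !mxE -expr2 lerDl.
  by apply: sumr_ge0 => j _; rewrite -expr2 sqr_ge0.
have in_box k (a u : 'rV[R]_k) : dotv (a - u) (a - u) <= r ^+ 2 -> box k a u.
  move=> au i; rewrite /= in_itv /=.
  have := le_trans (coord_le k a u i) au.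
  rewrite -[leLHS]real_normK ?num_real// ler_sqr ?nnegrE ?sqrtr_ge0// ler_norml.
  by move=> /andP[? ?]; apply/andP; split; lra.
pose A := S `&` [set w | Defs.edist z w <= r].
have Acompact : compact A.
  apply: (@subclosed_compact _ _ (box n z.1 `*` box m z.2)).
  - apply: closedI => //.
    apply: (@preimage_closed _ _ (Defs.edist z) [set x | x <= r]); last exact: closed_le.
    by move=> w _; apply: continuous_edist.
  - by apply: compact_setX.
  - move=> w [_ /= zw].
    have zw2 : Defs.edist z w ^+ 2 <= r ^+ 2 by rewrite ler_sqr ?nnegrE ?sqrtr_ge0.
    rewrite /edist sqr_sqrtr ?addr_ge0 ?dotv_ge0// in zw2.
    have := dotv_ge0 (z.1 - w.1); have := dotv_ge0 (z.2 - w.2).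
    by split; apply: in_box; lra.
have A0 : A !=set0 by exists s0; split => //=.
have [|s /set_mem[Ss sr] smin] := compact_EVT_min A0 Acompact (f := Defs.edist z).
  by apply: continuous_subspaceT; exact: continuous_edist.
exists s => //; apply/eqP; rewrite eq_le dist_set_le// andbT.
apply: lb_le_inf; first by exists (Defs.edist z s0), s0.
(* Points of [S] outside the ball are farther than [r], hence farther than [s]. *)
move=> _ [w Sw <-]; have [wr|rw] := leP (Defs.edist z w) r.
  by apply: smin; rewrite inE; split.
by apply: (le_trans sr); apply: ltW.
Qed.

(** * Saddle rectangle *)

Section Corners.
Context {R : realType} {n m : nat} {Lx Ly Lxy : R} {F : 'rV[R]_n * 'rV[R]_m -> R}.
Context {gx : 'rV[R]_n -> 'rV[R]_m -> 'rV[R]_n} {gy : 'rV[R]_n -> 'rV[R]_m -> 'rV[R]_m}.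
Hypotheses (Lx0 : 0 < Lx) (ccs : convex_concave_smooth Lx Ly Lxy F gx gy).
Let L := Num.max Lx Ly.

Let L_gt0 : 0 < L. Proof. by rewrite lt_max Lx0. Qed.

Lemma gx_lipschitz y x1 x2 : enorm (gx x2 y - gx x1 y) <= L * enorm (x2 - x1).
Proof.
have [_ _ _ lipx _] := ccs; apply: le_trans (lipx _ _ _) _.
by rewrite ler_wpM2r ?enorm_ge0// le_max lexx.
Qed.

Lemma gyN_lipschitz x y1 y2 : enorm (- gy x y2 - - gy x y1) <= L * enorm (y2 - y1).
Proof.
have [_ _ _ _ [lipy _ _]] := ccs.
rewrite -opprD enormN; apply: le_trans (lipy _ _ _) _.
by rewrite ler_wpM2r ?enorm_ge0// le_max lexx orbT.
Qed.

(** The common constant [L] lets inequalities of both blocks be added with one factor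
    [1 / (2 L)]. *)
Lemma interpolation_x y x1 x2 :
  F (x1, y) + dotv (gx x1 y) (x2 - x1)
    + dotv (gx x2 y - gx x1 y) (gx x2 y - gx x1 y) / (2 * L) <= F (x2, y).
Proof.
have [FG cvx _ _ _] := ccs.
apply: (convex_interpolation (fun x => F (x, y)) (gx ^~ y) x1 x2 L_gt0).
- exact: is_gradient_fst.
- exact: gx_lipschitz.
- exact: cvx.
Qed.

Lemma interpolation_y x y1 y2 :
  F (x, y2) <= F (x, y1) + dotv (gy x y1) (y2 - y1)
    - dotv (gy x y2 - gy x y1) (gy x y2 - gy x y1) / (2 * L).
Proof.
have [FG _ ccv _ _] := ccs.
have := convex_interpolation (fun y => - F (x, y)) (fun y => - gy x y) y1 y2 L_gt0.
rewrite -opprD !(dotvNl, dotvNr) opprK => H.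
suff : - F (x, y1) - dotv (gy x y1) (y2 - y1)
    + dotv (gy x y2 - gy x y1) (gy x y2 - gy x y1) / (2 * L) <= - F (x, y2).
  by move=> {}H; rewrite -lerN2; apply: le_trans H; rewrite !opprD opprK.
apply: H.
- by apply: is_gradientN; apply: (is_gradient_snd F gx gy).
- exact: gyN_lipschitz.
- by move=> u v l l01; have := ccv x u v l l01; lra.
Qed.

Lemma saddle_gradients s : saddle_set F s -> gx s.1 s.2 = 0 /\ gy s.1 s.2 = 0.
Proof.
case: s => s1 s2 sF; have [FG _ _ _ _] := ccs; split => /=.
  apply: (gradient_eq0_of_min (fun x => F (x, s2)) (gx ^~ s2) s1 L_gt0).
  - exact: is_gradient_fst.
  - exact: gx_lipschitz.
  - by move=> x; have [] := sF x s2.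
apply: oppr_inj; rewrite oppr0.
apply: (gradient_eq0_of_min (fun y => - F (s1, y)) (fun y => - gy s1 y) s2 L_gt0).
- by apply: is_gradientN; apply: (is_gradient_snd F gx gy).
- exact: gyN_lipschitz.
- by move=> y; have [] := sF s1 y; rewrite lerN2.
Qed.

(** [V] collects gradient changes along the two edges meeting at [(x, y)], and [W] along the two
    meeting at [s]; the subtracted terms of [W] vanish with the gradients at [s]. *)
Lemma saddle_corners s x y : saddle_set F s ->
  let z := row_mx (x - s.1) (y - s.2) in
  let G := row_mx (gx x y) (- gy x y) in
  let V := row_mx (gx x y - gx s.1 y) (- (gy x y - gy x s.2)) in
  let W := row_mx (gx x s.2) (- gy s.1 y) in
  [/\ dotv V V + dotv W W <= 2 * L * dotv G z,
      dotv V V + dotv W W <= 2 * L * (dotv V z + dotv W z - dotv G z),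
      dotv (G - V) (G - V) <= Lxy ^+ 2 * dotv z z &
      dotv (G - W) (G - W) <= Lxy ^+ 2 * dotv z z].
Proof.
case: s => s1 s2 sF /=.
have [gx0 gy0] := saddle_gradients _ sF; rewrite /= in gx0 gy0.
have [_ _ _ _ [_ lipxy lipyx]] := ccs.
have sub_swap k (u v : 'rV[R]_k) : dotv (u - v) (u - v) = dotv (v - u) (v - u).
  by rewrite -opprB dotvNl dotvNr opprK.
have sqr_lip k l (u : 'rV[R]_k) (v : 'rV[R]_l) :
    enorm u <= Lxy * enorm v -> dotv u u <= Lxy ^+ 2 * dotv v v.
  move=> uv; rewrite -!sqr_enorm -exprMn ler_sqr ?nnegrE ?enorm_ge0//.
  by apply: le_trans uv; apply: enorm_ge0.
have scale2L A B : A / (2 * L) <= B -> A <= 2 * L * B.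
  by rewrite ler_pdivrMr ?mulr_gt0// mulrC.
rewrite !opp_row_mx !add_row_mx !dotv_row_mx !opprK.
split.
- apply: scale2L.
  (* Slopes are taken at the corners [(x, y)] and [s]: the former yield [<G, z>], the latter
     vanish. *)
  have := interpolation_x y x s1; have := interpolation_x s2 s1 x.
  have := interpolation_y x y s2; have := interpolation_y s1 s2 y.
  rewrite gx0 gy0 !subr0 !dotv0l (sub_swap _ (gx s1 y)) (sub_swap _ (gy x s2)).
  rewrite -(opprB x) -(opprB y) !(dotvNl, dotvNr).
  by lra.
- apply: scale2L.
  (* Each edge is reversed: slopes are now taken at [(s1, y)] and [(x, s2)], where they assemble
     into [V + W - G]. *)
  have := interpolation_x y s1 x; have := interpolation_x s2 x s1.
  have := interpolation_y x s2 y; have := interpolation_y s1 y s2.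
  rewrite gx0 gy0 !sub0r -(opprB x) -(opprB y) !(dotvNl, dotvNr).
  rewrite !(dotvDl _ _ (x - s1)) !(dotvDl _ _ (y - s2)) !(dotvNl, dotvNr).
  by lra.
(* The blocks of [G - V] are, up to sign, gradients at the mixed corners, compared with the zero
   gradients at [s] by the cross Lipschitz bounds. *)
- have := sqr_lip _ _ _ _ (lipxy s1 s2 y); have := sqr_lip _ _ _ _ (lipyx s1 x s2).
  rewrite gx0 gy0 !subr0 opprB subrKC addKr dotvNl dotvNr opprK.
  by lra.
- have := sqr_lip _ _ _ _ (lipxy x s2 y); have := sqr_lip _ _ _ _ (lipyx s1 x y).
  rewrite [- gy x y + _]addrC (sub_swap _ (gy s1 y)).
  by lra.
Qed.

End Corners.

(** * Contraction of the distance in one gradient step *)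

Theorem theorem3p3 (R : realType) (n m : nat) (Lx Ly Lxy mu t : R)
  (F : 'rV[R]_n * 'rV[R]_m -> R)
  (gx : 'rV[R]_n -> 'rV[R]_m -> 'rV[R]_n)
  (gy : 'rV[R]_n -> 'rV[R]_m -> 'rV[R]_m) :
  0 < Lx -> 0 < Ly -> 0 <= Lxy ->
  convex_concave_smooth Lx Ly Lxy F gx gy ->
  saddle_set F !=set0 ->
  0 < mu -> quad_grad_growth mu F gx gy ->
  let L := Num.max Lx Ly in
  0 < t ->
  t < 2 * mu / (L * mu + 2 * Lxy * Num.sqrt (mu * (L - mu)) + Lxy ^+ 2) ->
  let alpha := t * (2 * t * Lxy * Num.sqrt (mu * (L - mu)) + mu * (L * t - 2)
                    + t * Lxy ^+ 2) + 1 in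
  forall (x1 : 'rV[R]_n) (y1 : 'rV[R]_m),
    let x2 := x1 - t *: gx x1 y1 in
    let y2 := y1 + t *: gy x1 y1 in
    (dist_set (saddle_set F) (x2, y2)) ^+ 2
      <= alpha * (dist_set (saddle_set F) (x1, y1)) ^+ 2.
Proof.
move=> Lx0 Ly0 Lxy0 ccs S0 mu0 growth L t0 tlt alpha x1 y1.
cbv zeta; set x2 := x1 - _; set y2 := y1 + _.
have Fc : continuous F.
  move=> z; have [FG _ _ _ _] := ccs; have [dF _] := FG z.1 z.2.
  by rewrite -surjective_pairing in dF; apply: differentiable_continuous.
have [s Ss sproj] := exists_projection _ (x1, y1) (closed_saddle_set F Fc) S0.
(* The projection [s] of the old point serves as a competitor for the new one. *)
have le_d2 : dist_set (saddle_set F) (x2, y2) ^+ 2 <= Defs.edist (x2, y2) s ^+ 2.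
  by rewrite ler_sqr ?nnegrE ?sqrtr_ge0 ?dist_set_ge0// dist_set_le.
apply: (le_trans le_d2).
have gr := growth x1 y1 s Ss sproj.
have L0 : 0 < L by rewrite lt_max Lx0.
have [fwd bwd HV HW] := saddle_corners Lx0 ccs s x1 y1 Ss.
rewrite -sproj in gr *.
move: fwd bwd HV HW; rewrite -/L.
set z := row_mx (x1 - s.1) (y1 - s.2); set G := row_mx (gx x1 y1) _.
set V := row_mx (_ - gx s.1 y1) _; set W := row_mx (gx x1 s.2) _ => fwd bwd HV HW.
have edist_z : Defs.edist (x1, y1) s ^+ 2 = dotv z z.
  by rewrite dotv_row_mx sqr_sqrtr ?addr_ge0 ?dotv_ge0.
have edist_z2 : Defs.edist (x2, y2) s ^+ 2 = dotv (z - t *: G) (z - t *: G).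
  rewrite /z /G scale_row_mx opp_row_mx add_row_mx dotv_row_mx.
  rewrite sqr_sqrtr ?addr_ge0 ?dotv_ge0//= /x2 /y2 scalerN opprK.
  by rewrite !(addrAC _ (- s.1)) !(addrAC _ (- s.2)).
rewrite edist_z edist_z2.
have -> : alpha = 1 - 2 * t * mu + t ^+ 2 * growth_rate L Lxy mu.
  by rewrite /alpha /growth_rate; ring.
(* If the start is already a saddle point, the ratio [nu] is meaningless; then [V = 0] and [G = 0],
   so the step does not move. *)
have [z0|zneq0] := eqVneq (dotv z z) 0.
  have z0' := dotv_eq0 _ z0; rewrite z0' !dotv0r mulr0 in fwd HV *.
  have V0 : V = 0 by apply: dotv_eq0; have := dotv_ge0 V; have := dotv_ge0 W; lra.
  rewrite V0 subr0 mulr0 in HV.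
  by rewrite sub0r dotvNl dotvNr opprK dotvZl dotvZr mulr0 !pmulr_rle0.
have step := step_contraction L Lxy mu t G V W z L0 Lxy0 mu0 _ _ fwd bwd HV HW t0 tlt.
apply: step.
  by rewrite lt_def zneq0 dotv_ge0.
by rewrite -edist_z (dotv_row_mx (gx x1 y1)) dotvNl.
Qed.
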